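(* Let $n\ge 1$, and let $P=\{z\in\mathbb{R}^{2n}: Az=b,\ z\ge 0\}$, with $A\in\mathbb{R}^{n\times 2n}$ of full row rank and $b\in\mathbb{R}^n$, be a polytope that is combinatorially equivalent to the standard cube $\mathcal{C}_n=\{(x,y)\in\mathbb{R}^n\times\mathbb{R}^n: x+y=\mathbf{1},\ x,y\ge 0\}$ and all of whose vertices are non-degenerate. Consider a linear program $\min\{c^\top z: z\in P\}$, $c\in\mathbb{R}^{2n}$, that has a single (unique) optimal basis $B^*$, and let $(x^0,y^0)\in\mathbb{R}^n\times\mathbb{R}^n$ be any vertex of $P$, taken as initial point. Then the length (number of pivots) of a path generated from $(x^0,y^0)$ by the pivot experts (Expert I or Expert II, given $B^*$) is at most $\frac{1}{2}\cdot\left(\text{\# DiffOpt of }(x^0,y^0)\right)$, which is at most $n$.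
   Context: Two polytopes are combinatorially equivalent if their face lattices are isomorphic (there is an inclusion-preserving one-to-one correspondence between their faces). A feasible basis is a set $B\subset\{1,\dots,2n\}$ of $n$ indices with $A_B$ invertible and $A_B^{-1}b\ge 0$; its basic feasible solution has $z_B=A_B^{-1}b$ and all other coordinates $0$. A vertex is non-degenerate if it has exactly $n$ positive coordinates; it then corresponds to exactly one feasible basis, the set of its positive coordinates. An optimal basis is a feasible basis whose basic feasible solution minimizes the objective. # DiffOpt: the status vector of a vertex has entry $1$ for each basic variable and entry $0$ for each non-basic variable (non-basic variables are at their lower bound $0$). # DiffOpt of a vertex is the $1$-norm of the difference between its status vector and the status vector of the given optimal basis $B^*$. Primal simplex method and pivot experts: at a vertex with basis $B$, the reduced costs are $\bar c_j=c_j-c_B^\top A_B^{-1}A_j$; the candidates to enter are the non-basic $j$ with $\bar c_j<0$; after an entering variable is chosen, the leaving variable is determined by the usual ratio test; the method stops when there is no candidate. Given $B^*$, Expert I selects, among the candidates belonging to $B^*$, one with the best (most negative) steepest-edge score $\bar c_j/\sqrt{\|A_B^{-1}A_j\|_2^2+1}$, and, in case of a tie in the ratio test, lets a variable not in $B^*$ leave if possible. Expert II performs the ratio test for every candidate in $B^*$, restricts to those for which a variable not in $B^*$ can be chosen to leave (if there are any; otherwise it keeps all candidates in $B^*$), and selects among these one with the best steepest-edge score, letting a variable not in $B^*$ leave if possible. *)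

(* Defs.v *)
From HB Require Import structures.
From mathcomp Require Import all_boot all_order all_algebra.
From mathcomp Require Import boolp classical_sets functions reals.

Set Implicit Arguments.
Unset Strict Implicit.
Unset Printing Implicit Defensive.

Import Order.TTheory GRing.Theory Num.Theory.
Local Open Scope ring_scope.

(* Faces are cut out by valid inequalities; [a = 0] yields the empty face
   ([d = 1]) and [P] itself ([d = 0]). *)
Definition face (R : realType) m (P F : set 'cV[R]_m) : Prop :=
  exists (a : 'cV[R]_m) (d : R),
    (forall z, P z -> (a^T *m z) 0 0 <= d) /\
    F = [set z | P z /\ (a^T *m z) 0 0 = d]%classic.

Definition vertex (R : realType) m (P : set 'cV[R]_m) (z : 'cV[R]_m) : Prop :=
  face P [set z]%classic.

Definition comb_equiv (R : realType) m k
    (P : set 'cV[R]_m) (Q : set 'cV[R]_k) : Prop :=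
  exists phi : set 'cV[R]_m -> set 'cV[R]_k,
    set_bij (face P) (face Q) phi /\
    forall F G, face P F -> face P G ->
      ((F `<=` G)%classic <-> (phi F `<=` phi G)%classic).

Definition bounded_points (R : realType) m (P : set 'cV[R]_m) : Prop :=
  exists M : R, forall z, P z -> forall i, `|z i 0| <= M.

Definition polyhedron (R : realType) n (A : 'M[R]_(n, n + n)) (b : 'cV[R]_n) :
    set 'cV[R]_(n + n) :=
  [set z | A *m z = b /\ forall i, 0 <= z i 0]%classic.

(* A point (x, y) of R^n x R^n is [col_mx x y]. *)
Definition cube (R : realType) n : set 'cV[R]_(n + n) :=
  [set z | usubmx z + dsubmx z = const_mx 1 /\ forall i, 0 <= z i 0]%classic.

Definition nondegenerate_vertex (R : realType) n (z : 'cV[R]_(n + n)) : bool :=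
  #|[set i | 0 < z i 0]| == n.

Definition nset (n : nat) := {B : {set 'I_(n + n)} | #|B| == n}.

(* The increasing enumeration of [B]; it orders the columns of [A_B]. *)
Definition nset_idx n (B : nset n) (k : 'I_n) : 'I_(n + n) :=
  enum_val (cast_ord (esym (eqP (valP B))) k).

Definition basis_mx (R : realType) n (A : 'M[R]_(n, n + n)) (B : nset n) :
  'M[R]_n := colsub (nset_idx B) A.

Definition basic_values (R : realType) n (A : 'M[R]_(n, n + n)) (b : 'cV[R]_n)
  (B : nset n) : 'cV[R]_n := invmx (basis_mx A B) *m b.

Definition feasible_basis (R : realType) n (A : 'M[R]_(n, n + n))
    (b : 'cV[R]_n) (B : nset n) : Prop :=
  basis_mx A B \in unitmx /\ forall k, 0 <= basic_values A b B k 0.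

Definition basic_solution (R : realType) n (A : 'M[R]_(n, n + n))
    (b : 'cV[R]_n) (B : nset n) : 'cV[R]_(n + n) :=
  \col_j (if [pick k | nset_idx B k == j] is Some k
          then basic_values A b B k 0 else 0).

Definition optimal_basis (R : realType) n (A : 'M[R]_(n, n + n)) (b : 'cV[R]_n)
    (c : 'cV[R]_(n + n)) (B : nset n) : Prop :=
  feasible_basis A b B /\
  forall z, polyhedron A b z ->
    (c^T *m basic_solution A b B) 0 0 <= (c^T *m z) 0 0.

Definition status (R : realType) n (B : nset n) : 'cV[R]_(n + n) :=
  \col_j (j \in val B)%:R.

Definition diff_opt (R : realType) n (Bopt B : nset n) : R :=
  \sum_j `|status R B j 0 - status R Bopt j 0|.

Definition entering_column (R : realType) n (A : 'M[R]_(n, n + n)) (B : nset n)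
  (j : 'I_(n + n)) : 'cV[R]_n := invmx (basis_mx A B) *m col j A.

Definition reduced_cost (R : realType) n (A : 'M[R]_(n, n + n))
    (c : 'cV[R]_(n + n)) (B : nset n) (j : 'I_(n + n)) : R :=
  c j 0 - ((rowsub (nset_idx B) c)^T *m invmx (basis_mx A B) *m col j A) 0 0.

Definition candidates (R : realType) n (A : 'M[R]_(n, n + n))
    (c : 'cV[R]_(n + n)) (B : nset n) : {set 'I_(n + n)} :=
  [set j | (j \notin val B) && (reduced_cost A c B j < 0)].

Definition score (R : realType) n (A : 'M[R]_(n, n + n))
    (c : 'cV[R]_(n + n)) (B : nset n) (j : 'I_(n + n)) : R :=
  reduced_cost A c B j /
  Num.sqrt (\sum_(k < n) entering_column A B j k 0 ^+ 2 + 1).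

Definition best (R : realType) n (A : 'M[R]_(n, n + n)) (c : 'cV[R]_(n + n))
    (B : nset n) (S : {set 'I_(n + n)}) : {set 'I_(n + n)} :=
  [set j in S | [forall i in S, score A c B j <= score A c B i]].

(* The minimizers of the ratio test when [j] enters. *)
Definition leaving (R : realType) n (A : 'M[R]_(n, n + n)) (b : 'cV[R]_n)
    (B : nset n) (j : 'I_(n + n)) : {set 'I_(n + n)} :=
  let x := basic_values A b B in
  let d := entering_column A B j in
  [set nset_idx B k | k : 'I_n &
    (0 < d k 0) &&
    [forall i : 'I_n, (0 < d i 0) ==> (x k 0 / d k 0 <= x i 0 / d i 0)]].

Definition expert_leaving (R : realType) n (A : 'M[R]_(n, n + n))
    (b : 'cV[R]_n) (Bopt B : nset n) (j : 'I_(n + n)) : {set 'I_(n + n)} :=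
  let L := leaving A b B j in
  if L :\: val Bopt == finset.set0 then L else L :\: val Bopt.

Definition expertI_entering (R : realType) n (A : 'M[R]_(n, n + n))
    (c : 'cV[R]_(n + n)) (Bopt B : nset n) : {set 'I_(n + n)} :=
  best A c B (candidates A c B :&: val Bopt).

Definition expertII_entering (R : realType) n (A : 'M[R]_(n, n + n))
    (b : 'cV[R]_n) (c : 'cV[R]_(n + n)) (Bopt B : nset n) :
    {set 'I_(n + n)} :=
  let C := candidates A c B :&: val Bopt in
  let C' := [set j in C | leaving A b B j :\: val Bopt != finset.set0] in
  best A c B (if C' == finset.set0 then C else C').

(* Ties may remain in the choices of [j] and [l]: a pivot expert is a relation
   on bases, covering every way of breaking them. *)
Definition expertI_pivot (R : realType) n (A : 'M[R]_(n, n + n))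
    (b : 'cV[R]_n) (c : 'cV[R]_(n + n)) (Bopt : nset n) : rel (nset n) :=
  fun B B' =>
    [exists j in expertI_entering A c Bopt B,
     exists l in expert_leaving A b Bopt B j, val B' == j |: (val B :\ l)].

Definition expertII_pivot (R : realType) n (A : 'M[R]_(n, n + n))
    (b : 'cV[R]_n) (c : 'cV[R]_(n + n)) (Bopt : nset n) : rel (nset n) :=
  fun B B' =>
    [exists j in expertII_entering A b c Bopt B,
     exists l in expert_leaving A b Bopt B j, val B' == j |: (val B :\ l)].

(* Main.v *)
(* A proper nonempty face of P lies in one of the proper faces
   F_i = {z in P | z_i = 0}; so each of the 2n facets of the cube corresponds to
   some F_i, and by counting this is a bijection between the facets of the cube
   and the 2n indices.  Opposite facets of the cube are disjoint, and a feasible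
   basis B gives a vertex lying on the n facets F_i with i outside B; hence B
   contains exactly one index of each pair of opposite facets.  A pivot thus
   exchanges the two indices of a pair: when the entering one belongs to B*, the
   leaving one does not, and # DiffOpt drops by 2. *)
Require Import Defs.
From HB Require Import structures.
From mathcomp Require Import all_boot all_order all_algebra.
From mathcomp Require Import boolp classical_sets functions reals.
From mathcomp Require Import ring lra.

Set Implicit Arguments.
Unset Strict Implicit.
Unset Printing Implicit Defensive.

Import Order.TTheory GRing.Theory Num.Theory.
Local Open Scope ring_scope.

(** * Vectors supported on a basis *)

Definition supp_in (R : realType) (m : nat) (B : {set 'I_m}) (z : 'cV[R]_m) :=
  forall i, i \notin B -> z i 0 = 0.

(** Taking [basic_values A b B] for [v] gives [basic_solution A b B] by conversion, so the lemmas on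
    [extend] apply to basic solutions directly. *)
Definition extend (R : realType) (n : nat) (B : nset n) (v : 'cV[R]_n) :
    'cV[R]_(n + n) :=
  \col_j (if [pick k | nset_idx B k == j] is Some k then v k 0 else 0).

Lemma nset_idx_inj (n : nat) (B : nset n) : injective (nset_idx B).
Proof. by move=> k l /enum_val_inj /cast_ord_inj. Qed.

Lemma nset_idxP (n : nat) (B : nset n) (i : 'I_(n + n)) :
  reflect (exists k, i = nset_idx B k) (i \in val B).
Proof.
apply: (iffP idP) => [iB|[k ->]]; last exact: enum_valP.
exists (cast_ord (eqP (valP B)) (enum_rank_in iB i)).
by rewrite /nset_idx cast_ordK enum_rankK_in.
Qed.

Lemma extend_idx (R : realType) (n : nat) (B : nset n) (v : 'cV[R]_n) k :
  extend B v (nset_idx B k) 0 = v k 0.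
Proof.
rewrite mxE; case: pickP => [l /eqP/nset_idx_inj->//|/(_ k)].
by rewrite eqxx.
Qed.

Lemma extend_supp (R : realType) (n : nat) (B : nset n) (v : 'cV[R]_n) :
  supp_in (val B) (extend B v).
Proof.
move=> i iB; rewrite mxE; case: pickP => // k /eqP ki.
by case/negP: iB; apply/nset_idxP; exists k.
Qed.

Lemma supp_inE (R : realType) (n : nat) (B : nset n) (z : 'cV[R]_(n + n)) :
  supp_in (val B) z -> z = extend B (rowsub (nset_idx B) z).
Proof.
move=> zB; apply/colP => i; case: (boolP (i \in val B)) => iB.
  by case/nset_idxP: iB => k ->; rewrite extend_idx mxE.
by rewrite zB // extend_supp.
Qed.

Lemma mul_extend (R : realType) (n : nat) (A : 'M[R]_(n, n + n)) (B : nset n)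
    (v : 'cV[R]_n) :
  A *m extend B v = basis_mx A B *m v.
Proof.
apply/colP => r; rewrite !mxE (bigID (mem (val B))) /= [X in _ + X]big1 ?addr0.
  rewrite big_enum_val /=.
  rewrite (reindex (cast_ord (esym (eqP (valP B))))) /=; last first.
    by exists (cast_ord (eqP (valP B))) => ? _; rewrite ?cast_ordK ?cast_ordKV.
  by apply: eq_bigr => k _; rewrite extend_idx mxE.
by move=> i iB; rewrite extend_supp // mulr0.
Qed.

(** By [mul_extend], [A] acts on vectors supported on [B] as [basis_mx A B] acts on their basic
    entries. The kernel form avoids the enumeration of [B], so that two bases can be compared. *)
Lemma basis_unitP (R : realType) (n : nat) (A : 'M[R]_(n, n + n)) (B : nset n) :
  basis_mx A B \in unitmx <->
  forall u : 'cV_(n + n), A *m u = 0 -> supp_in (val B) u -> u = 0.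
Proof.
split=> [AB u Au uB|inj].
  have uE := supp_inE uB; rewrite uE; move: Au; rewrite uE mul_extend -uE.
  move=> /(congr1 (mulmx (invmx (basis_mx A B)))); rewrite mulKmx // mulmx0 => ->.
  by apply/colP => i; rewrite !mxE; case: pickP => // k _; rewrite mxE.
(* [inj_row_free] tests left kernels, hence the transposes. *)
rewrite -unitmx_tr -row_free_unit; apply: inj_row_free => v vA.
have : extend B v^T = 0.
  apply: inj; last exact: extend_supp.
  by rewrite mul_extend -[LHS]trmxK trmx_mul trmxK vA trmx0.
move=> e; apply/rowP => k.
by move/colP: e => /(_ (nset_idx B k)); rewrite extend_idx !mxE.
Qed.

(** * Feasible bases, their vertices, and pivots *)

Lemma feasible_basisP (R : realType) (n : nat) (A : 'M[R]_(n, n + n))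
    (b : 'cV[R]_n) (B : nset n) :
  feasible_basis A b B <->
  basis_mx A B \in unitmx /\
  exists2 z, polyhedron A b z & supp_in (val B) z.
Proof.
split=> -[AB H]; split=> //.
  exists (extend B (basic_values A b B)); last exact: extend_supp.
  split; first by rewrite mul_extend mulKVmx.
  by move=> i; rewrite mxE; case: pickP.
case: H => z [Az z0] zB k; rewrite /basic_values -Az.
by rewrite {1}(supp_inE zB) mul_extend mulKmx // mxE.
Qed.

Lemma basic_solution_polyhedron (R : realType) (n : nat)
    (A : 'M[R]_(n, n + n)) (b : 'cV[R]_n) (B : nset n) :
  feasible_basis A b B -> polyhedron A b (basic_solution A b B).
Proof.
move=> [AB x0]; split; first by rewrite [LHS]mul_extend mulKVmx.
by move=> i; rewrite mxE; case: pickP.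
Qed.

Lemma dot_delta (R : realType) (m : nat) (i : 'I_m) (z : 'cV[R]_m) :
  ((- delta_mx i 0 : 'cV_m)^T *m z) 0 0 = - z i 0.
Proof. by rewrite linearN /= trmx_delta mulNmx -rowE !mxE. Qed.

(** Minus the sum of the non-basic coordinates is at most 0 on the polyhedron, with equality only if
    all of them vanish; invertibility of [basis_mx A B] then leaves a single point. *)
Lemma basic_solution_vertex (R : realType) (n : nat)
    (A : 'M[R]_(n, n + n)) (b : 'cV[R]_n) (B : nset n) :
  feasible_basis A b B -> vertex (polyhedron A b) (basic_solution A b B).
Proof.
move=> fB; have [AB _] := fB; have Px := basic_solution_polyhedron fB.
exists (\sum_(i | i \notin val B) - delta_mx i 0), 0.
have dotE (z : 'cV[R]_(n + n)) :
    ((\sum_(i | i \notin val B) - delta_mx i 0 : 'cV_(n + n))^T *m z) 0 0 =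
              - \sum_(i | i \notin val B) z i 0.
  rewrite linear_sum /= mulmx_suml summxE -sumrN.
  by apply: eq_bigr => i _; rewrite dot_delta.
split=> [z [_ z0]|]; first by rewrite dotE oppr_le0 sumr_ge0.
apply/seteqP; split=> [z ->|z] /=.
  by split=> //; rewrite dotE big1 ?oppr0 // => i; apply: extend_supp.
move=> [[Az z0]]; rewrite dotE => /eqP; rewrite oppr_eq0.
rewrite psumr_eq0 // => /allP zB.
apply/eqP; rewrite -subr_eq0; apply/eqP.
apply: ((basis_unitP _ _).1 AB) => [|i iB].
  by rewrite mulmxBr Az (proj1 Px) subrr.
have /implyP/(_ iB)/eqP zi := zB i (mem_index_enum _).
by rewrite mxE zi mxE extend_supp // subr0.
Qed.

(** The ratio test gives the longest step along which raising coordinate [j] keeps the basic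
    coordinates nonnegative, and coordinate [l] vanishes at its end. The new basis is invertible
    because the pivot entry [d k 0] is nonzero. *)
Lemma pivot_feasible (R : realType) (n : nat)
    (A : 'M[R]_(n, n + n)) (b : 'cV[R]_n) (B B' : nset n) j l :
  feasible_basis A b B -> j \notin val B -> l \in leaving A b B j ->
  val B' = (j |: (val B :\ l))%SET -> feasible_basis A b B'.
Proof.
move=> [AB x0] jB /imsetP[k]; rewrite inE => /andP[dk_gt0 /forallP dk_min] lE B'E.
set x := basic_values A b B in x0 dk_min.
set d := entering_column A B j in dk_gt0 dk_min.
(* Minus the direction of the move: a kernel vector of [A] with entry -1 at [j] and 0 at the other
   indices outside [B]. *)
pose D := extend B d - delta_mx j 0.
have AD : A *m D = 0.
  by rewrite mulmxBr mul_extend mulKVmx // -colE subrr.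
have lj : l != j.
  by apply: contraNneq jB => <-; rewrite lE; apply/nset_idxP; exists k.
have DB m : nset_idx B m != j -> D (nset_idx B m) 0 = d m 0.
  by move=> mj; rewrite mxE extend_idx !mxE (negPf mj) subr0.
have Dl : D l 0 = d k 0 by rewrite lE DB // -lE.
have Dj : D j 0 = -1.
  by rewrite mxE extend_supp // !mxE !eqxx sub0r.
have Dout i : i != j -> i \notin val B -> D i 0 = 0.
  by move=> ij iB; rewrite mxE extend_supp // !mxE (negPf ij) subr0.
have outB' i : i \notin val B' -> i != j /\ (i = l \/ i \notin val B).
  rewrite B'E !inE negb_or negb_and negbK => /andP[-> /orP[/eqP|]]; by auto.
apply/feasible_basisP; split.
  apply/basis_unitP => u Au uB'.
  (* Adding [u j 0 *: D] cancels coordinate [j], so the sum is supported on [B] and must vanish. Its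
     coordinate [l] is [u j 0 * d k 0], which forces [u j 0 = 0]. *)
  have uD : u + u j 0 *: D = 0.
    apply: ((basis_unitP _ _).1 AB) => [|i iB].
      by rewrite mulmxDr -scalemxAr AD Au scaler0 addr0.
    rewrite mxE [X in _ + X]mxE; case: (eqVneq i j) => [->|ij].
      by rewrite Dj mulrN1 subrr.
    rewrite (Dout i ij iB) mulr0 addr0 uB' // B'E !inE negb_or ij.
    by rewrite (negPf iB) andbF.
  have ul : u l 0 = 0.
    by apply: uB'; rewrite B'E !inE (negPf lj) eqxx.
  have : (u + u j 0 *: D) l 0 = 0 by rewrite uD mxE.
  rewrite mxE ul add0r mxE Dl => /eqP; rewrite mulf_eq0 (gt_eqF dk_gt0) orbF.
  by move=> /eqP uj; rewrite uj scale0r addr0 in uD.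
pose th := x k 0 / d k 0.
have th0 : 0 <= th by rewrite divr_ge0 // ltW.
exists (extend B x - th *: D).
  split; first by rewrite mulmxBr -scalemxAr AD scaler0 subr0 mul_extend mulKVmx.
  move=> i; rewrite mxE [X in _ + X]mxE [X in _ - X]mxE.
  case: (boolP (i \in val B)) => [/nset_idxP[m im]|iB]; last first.
    rewrite extend_supp // add0r; case: (eqVneq i j) => [->|ij].
      by rewrite Dj mulrN1 opprK.
    by rewrite Dout // mulr0 oppr0.
  have mj : nset_idx B m != j.
    by apply: contraNneq jB => <-; apply/nset_idxP; exists m.
  rewrite im DB // extend_idx subr_ge0.
  have [dm|dm] := ltP 0 (d m 0).
    by rewrite -ler_pdivlMr //; have /implyP/(_ dm) := dk_min m.
  by apply: le_trans (x0 m); rewrite mulr_ge0_le0.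
move=> i /outB' [ij]; rewrite mxE [X in _ + X]mxE [X in _ - X]mxE.
case=> [->|iB]; last by rewrite extend_supp // Dout // mulr0 subr0.
by rewrite Dl lE extend_idx /th divfK ?gt_eqF // subrr.
Qed.

(** * Faces of a polyhedron in standard form *)

(** Despite the name, for general [A] and [b] this face may be empty, of lower dimension, or the
    whole polyhedron. *)
Definition facet (R : realType) (n : nat) (A : 'M[R]_(n, n + n)) (b : 'cV[R]_n)
    (i : 'I_(n + n)) : set 'cV[R]_(n + n) :=
  [set z | polyhedron A b z /\ z i 0 = 0]%classic.

Lemma face_facet (R : realType) (n : nat) (A : 'M[R]_(n, n + n)) (b : 'cV[R]_n)
    (i : 'I_(n + n)) : face (polyhedron A b) (facet A b i).
Proof.
exists (- delta_mx i 0), 0; split=> [z [_ z0]|].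
  by rewrite dot_delta oppr_le0.
apply/seteqP; split=> z /= [Pz zi]; split=> //.
  by rewrite dot_delta zi oppr0.
by move: zi; rewrite dot_delta => /eqP; rewrite oppr_eq0 => /eqP.
Qed.

Lemma face0 (R : realType) (m : nat) (P : set 'cV[R]_m) : face P set0.
Proof.
exists 0, 1; split=> [z _|]; first by rewrite trmx0 mul0mx mxE ler01.
apply/seteqP; split=> z //= -[_]; rewrite trmx0 mul0mx mxE => /esym/eqP.
by rewrite oner_eq0.
Qed.

Lemma faceT (R : realType) (m : nat) (P : set 'cV[R]_m) : face P P.
Proof.
exists 0, 0; split=> [z _|]; first by rewrite trmx0 mul0mx mxE.
by apply/seteqP; split=> z //= => [Pz|[]//]; rewrite trmx0 mul0mx mxE.
Qed.

Lemma face_sub (R : realType) (m : nat) (P F : set 'cV[R]_m) :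
  face P F -> (F `<=` P)%classic.
Proof. by move=> [a [d [_ ->]]] z []. Qed.

Lemma face_midpoint (R : realType) (n : nat) (A : 'M[R]_(n, n + n))
    (b : 'cV[R]_n) (F : set 'cV[R]_(n + n)) (x y : 'cV[R]_(n + n)) :
  face (polyhedron A b) F -> F x -> F y -> F (2^-1 *: (x + y)).
Proof.
move=> [a [d [_ ->]]] [[Ax x0] ax] [[Ay y0] ay].
have half m (v : 'cV[R]_m) : 2^-1 *: (v + v) = v.
  by rewrite -mulr2n -scaler_nat scalerA mulVf ?scale1r // pnatr_eq0.
split; first split.
- by rewrite -scalemxAr mulmxDr Ax Ay half.
- by move=> i; rewrite !mxE mulr_ge0 ?invr_ge0 ?addr_ge0.
- by rewrite -scalemxAr mulmxDr mxE [X in _ * X]mxE ax ay; field.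
Qed.

(* The segment from [z] to [z0] can be prolonged inside the polyhedron beyond
   [z0], so a linear form that is maximal at [z0] is maximal at [z] too. *)
Lemma face_relint (R : realType) (n : nat) (A : 'M[R]_(n, n + n))
    (b : 'cV[R]_n) (F : set 'cV[R]_(n + n)) (z0 : 'cV[R]_(n + n)) :
  face (polyhedron A b) F -> F z0 ->
  (forall i, 0 < z0 i 0 \/ facet A b i = polyhedron A b) ->
  F = polyhedron A b.
Proof.
move=> [a [d [ad ->]]] [[Az0 z0_ge0] az0] z0_gt0.
apply/seteqP; split=> [z []//|z Pz]; split=> //.
have [Az z_ge0] := Pz.
(* The inverse of [t] dominates each ratio [z i 0 / z0 i 0], whence [t * z i 0 <= z0 i 0] where
   [z0 i 0] is positive. Terms with [z0 j 0 = 0] are 0, as division by zero gives 0; the summand 1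
   keeps [t] positive. *)
pose t := (1 + \sum_j z j 0 / z0 j 0)^-1.
have sum_ge0 : 0 <= \sum_j z j 0 / z0 j 0 by apply: sumr_ge0 => j _; rewrite divr_ge0.
have t_gt0 : 0 < t by rewrite invr_gt0; lra.
have tz i : t * z i 0 <= z0 i 0.
  case: (z0_gt0 i) => [z0i|Fi]; last first.
    have [_ ->] : facet A b i z by rewrite Fi.
    by rewrite mulr0.
  rewrite mulrC ler_pdivrMr; last lra.
  rewrite mulrDr mulr1 (bigD1 i) //= mulrDr mulrCA divff ?gt_eqF // mulr1.
  have : 0 <= z0 i 0 * \sum_(j | j != i) z j 0 / z0 j 0.
    by rewrite mulr_ge0 // sumr_ge0 // => j _; rewrite divr_ge0.
  by move: (z0_ge0 i); lra.
have /ad : polyhedron A b (z0 + t *: (z0 - z)).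
  split; first by rewrite mulmxDr -scalemxAr mulmxBr Az0 Az subrr scaler0 addr0.
  move=> i; rewrite !mxE mulrBr.
  have := mulr_ge0 (ltW t_gt0) (z0_ge0 i); have := tz i; lra.
rewrite mulmxDr -scalemxAr mulmxBr mxE [X in _ + X]mxE.
rewrite [X in _ * X]mxE [X in _ * (_ + X)]mxE.
rewrite az0 gerDl pmulr_rle0 // subr_le0 => daz.
by apply/le_anti; rewrite daz ad.
Qed.

(** Otherwise, for each [i] whose [facet A b i] is not the whole polyhedron, [F] has a point with
    positive coordinate [i]. Averaging these points gives one to which [face_relint] applies, so [F]
    would be the polyhedron. *)
Lemma face_sub_facet (R : realType) (n : nat) (A : 'M[R]_(n, n + n))
    (b : 'cV[R]_n) (F : set 'cV[R]_(n + n)) :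
  face (polyhedron A b) F -> (F !=set0)%classic -> F <> polyhedron A b ->
  exists i, (F `<=` facet A b i)%classic /\ facet A b i <> polyhedron A b.
Proof.
move=> fF [p Fp] FP; apply: contrapT => noi; apply: FP.
have pos i : facet A b i <> polyhedron A b -> exists2 z, F z & 0 < z i 0.
  move=> Fi; apply: contrapT => noz; apply: noi; exists i; split=> // z Fz.
  have Pz := face_sub fF Fz; split=> //.
  apply/eqP; apply: contra_notT noz => zi; exists z => //.
  by rewrite lt_def zi; apply: (proj2 Pz).
have F_ge0 z i : F z -> 0 <= z i 0 by move=> /(face_sub fF) [].
suff [z0 Fz0 z0P] : exists2 z0, F z0 & forall i, i \in enum 'I_(n + n) ->
    facet A b i <> polyhedron A b -> 0 < z0 i 0.
  apply: (face_relint (z0 := z0)) => // i.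
  have [->|Fi] := pselect (facet A b i = polyhedron A b); first by right.
  by left; apply: z0P => //; rewrite mem_enum.
(* The point is built index by index: a midpoint with a point positive at the new index stays
   positive at the earlier ones, all coordinates being nonnegative. *)
elim: (enum _) => [|i s [z Fz zs]]; first by exists p.
have [Fi|Fi] := pselect (facet A b i = polyhedron A b).
  by exists z => // k; rewrite inE => /orP[/eqP->//|]; exact: zs.
have [y Fy yi] := pos i Fi.
exists (2^-1 *: (z + y)); first exact: face_midpoint fF Fz Fy.
move=> k; rewrite !mxE inE => /orP[/eqP->_|ks Fk].
  by rewrite mulr_gt0 ?invr_gt0 ?ltr0n // ltr_wpDl ?F_ge0.
by rewrite mulr_gt0 ?invr_gt0 ?ltr0n // ltr_pwDl ?F_ge0 ?zs.
Qed.

(** * The cube and its facets *)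

Definition cube_mx (R : realType) (n : nat) : 'M[R]_(n, n + n) := row_mx 1%:M 1%:M.

(** Puts the cube in the same standard form, so that the lemmas on faces serve both sides of the
    equivalence. *)
Lemma cubeE (R : realType) (n : nat) :
  @cube R n = polyhedron (cube_mx R n) (const_mx 1).
Proof.
apply/seteqP; split=> z [e z0]; split=> //.
  by rewrite -[z]vsubmxK mul_row_col !mul1mx.
by move: e; rewrite -{1}[z]vsubmxK mul_row_col !mul1mx.
Qed.

(** Exchanges the positions of [x_i] and [y_i]. These coordinates sum to 1 on the cube, so the
    facets of [k] and [opp_idx k] are opposite and disjoint. *)
Definition opp_idx (n : nat) (k : 'I_(n + n)) : 'I_(n + n) :=
  match fintype.split k with inl i => rshift n i | inr i => lshift n i end.

Lemma opp_idxK (n : nat) : involutive (@opp_idx n).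
Proof.
move=> k; rewrite /opp_idx; case: (fintype.splitP k) => i ki.
  by rewrite (unsplitK (inr i)); apply: val_inj.
by rewrite (unsplitK (inl i)); apply: val_inj.
Qed.

Lemma cube_coord (R : realType) (n : nat) (z : 'cV[R]_(n + n)) :
  cube z <-> (forall k, z k 0 + z (opp_idx k) 0 = 1) /\ forall i, 0 <= z i 0.
Proof.
split=> -[e z0]; split=> //.
  move=> k; rewrite -[k]fintype.splitK /opp_idx.
  case: (fintype.split k) => i; rewrite unsplitK /=.
    by move/colP: e => /(_ i); rewrite !mxE.
  by move/colP: e => /(_ i); rewrite !mxE addrC.
apply/colP => i; rewrite !mxE -(e (lshift n i)) /opp_idx.
by rewrite (unsplitK (inl i)).
Qed.

Lemma opp_idx_neq (n : nat) (k : 'I_(n + n)) : opp_idx k != k.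
Proof.
rewrite -{2}[k]fintype.splitK /opp_idx; case: (fintype.split k) => i /=.
  by rewrite eq_rlshift.
by rewrite eq_lrshift.
Qed.

(** Coordinate [k] is its only zero, so it lies on facet [k] of the cube and on no other. *)
Definition facet_center (R : realType) (n : nat) (k : 'I_(n + n)) : 'cV[R]_(n + n) :=
  \col_i (if i == k then 0 else if i == opp_idx k then 1 else 2^-1).

Lemma facet_center_cube (R : realType) (n : nat) (k : 'I_(n + n)) :
  cube (facet_center R k).
Proof.
apply/cube_coord; split=> i; rewrite !mxE; last first.
  by case: ifP => // _; case: ifP => // _; rewrite invr_ge0.
rewrite (inj_eq (inv_inj (@opp_idxK n))) -(inv_eq (@opp_idxK n)).
case: (eqVneq i k) => [->|ik]; first by rewrite (negPf (opp_idx_neq _)) add0r.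
case: (eqVneq (opp_idx i) k) => _; first by rewrite addr0.
by field.
Qed.

Lemma facet_center_gt0 (R : realType) (n : nat) (k i : 'I_(n + n)) :
  i != k -> 0 < facet_center R k i 0.
Proof.
by move=> ik; rewrite mxE (negPf ik); case: ifP => // _; rewrite invr_gt0.
Qed.

(** If [G] had a point with positive coordinate [k], its midpoint with the centre of facet [k] would
    be positive everywhere, and [face_relint] would make [G] the whole cube. *)
Lemma cube_facet_max (R : realType) (n : nat) (k : 'I_(n + n))
    (G : set 'cV[R]_(n + n)) :
  face (@cube R n) G -> G <> @cube R n ->
  (facet (cube_mx R n) (const_mx 1) k `<=` G)%classic ->
  G = facet (cube_mx R n) (const_mx 1) k.
Proof.
move=> fG GQ kG; apply/seteqP; split=> // z Gz.
have Qz := face_sub fG Gz.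
split; first by rewrite -cubeE.
apply: contra_notP GQ => /eqP zk; rewrite cubeE in fG *.
have Gc : G (facet_center R k).
  by apply: kG; split; [rewrite -cubeE; exact: facet_center_cube|rewrite mxE eqxx].
apply: (face_relint fG (face_midpoint fG Gc Gz)) => i.
left; have [_ z0] := Qz.
rewrite mxE mulr_gt0 ?invr_gt0 // mxE.
case: (eqVneq i k) => [->|ik].
  by rewrite ltr_wpDl // ?lt_def ?zk ?z0 // mxE eqxx.
by rewrite ltr_pwDl ?facet_center_gt0.
Qed.

(** * Facets under the combinatorial equivalence *)

(** The preimage of cube facet [k] is a proper nonempty face, hence lies in some proper
    [facet A b i]. The image of the latter is a proper face of the cube containing facet [k], and
    [cube_facet_max] gives equality. *)
Lemma index_of_cube_facet (R : realType) (n : nat)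
    (A : 'M[R]_(n, n + n)) (b : 'cV[R]_n)
    (phi : set 'cV[R]_(n + n) -> set 'cV[R]_(n + n)) :
  set_bij (face (polyhedron A b)) (face (@cube R n)) phi ->
  (forall F G, face (polyhedron A b) F -> face (polyhedron A b) G ->
      ((F `<=` G)%classic <-> (phi F `<=` phi G)%classic)) ->
  forall k, exists i, phi (facet A b i) = facet (cube_mx R n) (const_mx 1) k.
Proof.
move=> [phi_fun phi_inj phi_surj] phi_le k.
set Gk := facet (cube_mx R n) (const_mx 1) k.
have fGk : face (@cube R n) Gk by rewrite cubeE; exact: face_facet.
have Gkc : Gk (facet_center R k).
  by split; [rewrite -cubeE; exact: facet_center_cube|rewrite mxE eqxx].
have GkQ : ~ (@cube R n `<=` Gk)%classic.
  move=> /(_ _ (facet_center_cube R (opp_idx k))) [_] /eqP.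
  by rewrite gt_eqF // facet_center_gt0 // eq_sym opp_idx_neq.
have [F fF FGk] := phi_surj _ fGk.
(* It is not assumed that [phi] preserves the top and bottom faces; comparing [F] with the preimages
   of the cube and of the empty face does instead. *)
have [T fT TQ] := phi_surj _ (faceT (@cube R n)).
have [E fE E0] := phi_surj _ (face0 (@cube R n)).
have F0 : (F !=set0)%classic.
  apply/set0P/eqP => F0; have : (F `<=` E)%classic by rewrite F0.
  by move=> /(phi_le _ _ fF fE); rewrite FGk E0 => /(_ _ Gkc).
have FP : F <> polyhedron A b.
  move=> FP; apply: GkQ; rewrite -FGk -TQ; apply/(phi_le _ _ fT fF).
  by rewrite FP; exact: face_sub fT.
have [i [Fi FiP]] := face_sub_facet fF F0 FP.
have fFi := face_facet A b i.
exists i; apply: cube_facet_max; first exact: phi_fun.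
  move=> e; apply: FiP; apply/seteqP; split; first exact: face_sub fFi.
  apply/(phi_le _ _ (faceT _) fFi); rewrite e.
  exact: face_sub (phi_fun _ (faceT _)).
by rewrite -/Gk -FGk; apply/(phi_le _ _ fF fFi).
Qed.

(** The pairing [sigma] is [opp_idx] carried over by the bijection [tau] from cube facets to
    indices. If [i] and [sigma i] were both non-basic, the image of the vertex would have a point on
    two opposite facets of the cube. *)
Lemma feasible_basis_pairing (R : realType) (n : nat)
    (A : 'M[R]_(n, n + n)) (b : 'cV[R]_n) :
  comb_equiv (polyhedron A b) (@cube R n) ->
  exists sigma : 'I_(n + n) -> 'I_(n + n), forall B, feasible_basis A b B ->
    forall i, (sigma i \in val B) = (i \notin val B).
Proof.
move=> [phi [phi_bij phi_le]].
have [tau tauP] := choice (index_of_cube_facet phi_bij phi_le).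
have [phi_fun _ _] := phi_bij.
(* If [tau k = tau l], facets [k] and [l] of the cube coincide, but the centre of facet [k] lies on
   no other facet. *)
have tau_inj : injective tau.
  move=> k l kl; apply/eqP; apply: contraT => neq_kl.
  have : facet (cube_mx R n) (const_mx 1) l (facet_center R k).
    rewrite -tauP -kl tauP; split; last by rewrite mxE eqxx.
    by rewrite -cubeE; exact: facet_center_cube.
  by move=> [_] /eqP; rewrite gt_eqF // facet_center_gt0 // eq_sym.
have [tau' tauK tau'K] := injF_bij tau_inj.
pose sigma i := tau (opp_idx (tau' i)).
have sigmaK : involutive sigma by move=> i; rewrite /sigma tauK opp_idxK tau'K.
exists sigma => B fB.
have vx := basic_solution_vertex fB.
set x := basic_solution A b B in vx.
have Px : polyhedron A b x := basic_solution_polyhedron fB.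
have sub i : i \notin val B -> ([set x] `<=` facet A b i)%classic.
  by move=> iB z ->; split=> //; rewrite /x [LHS](extend_supp _ iB).
have pair i : i \notin val B -> sigma i \in val B.
  move=> iB; apply: contraT => siB.
  have [w xw] : (phi [set x] !=set0)%classic.
    apply/set0P/eqP => e.
    have : ([set x] `<=` set0)%classic by apply/(phi_le _ _ vx (face0 _)); rewrite e.
    by move=> /(_ x erefl).
  have Gw k : tau k \notin val B -> w k 0 = 0.
    move=> /sub /(phi_le _ _ vx (face_facet A b _)) /(_ _ xw).
    by rewrite tauP => -[].
  have /cube_coord[/(_ (tau' i)) + _] := face_sub (phi_fun _ vx) xw.
  rewrite !Gw ?tau'K // addr0 => /esym/eqP; by rewrite oner_eq0.
have sigma_inj := inv_inj sigmaK.
(* [B] and its complement both have [n] elements, so the injection [sigma] from the complement into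
   [B] is onto; this turns the implication [pair] into an equivalence. *)
have img : imset sigma (mem (~: val B)%SET) = val B.
  apply/eqP; rewrite eqEcard card_imset // [X in (_ <= X)%N]cardsCs finset.setCK card_ord.
  rewrite (eqP (valP B)) addnK leqnn andbT.
  by apply/fintype.subsetP => _ /imsetP[i + ->]; rewrite inE; exact: pair.
by move=> i; rewrite -{1}img mem_imset // inE.
Qed.

(** * # DiffOpt as a cardinality, and its drop in a pivot *)

Definition disagree (n : nat) (B C : nset n) : {set 'I_(n + n)} :=
  [set j | (j \in val B) (+) (j \in val C)].

Lemma diff_optE (R : realType) (n : nat) (Bopt B : nset n) :
  diff_opt R Bopt B = #|disagree B Bopt|%:R.
Proof.
rewrite -sum1_card natr_sum big_mkcond; apply: eq_bigr => j _; rewrite !mxE inE.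
by do 2!case: (_ \in _); rewrite ?subrr ?normr0 ?subr0 ?sub0r ?normrN ?normr1.
Qed.

(** Both [j] and [l] leave the symmetric difference, and no other index changes status. *)
Lemma disagree_exchange (n : nat) (B B' C : nset n) j l :
  j \notin val B -> j \in val C -> l \in val B -> l \notin val C ->
  val B' = (j |: (val B :\ l))%SET ->
  #|disagree B C| = #|disagree B' C|.+2.
Proof.
move=> jB jC lB lC B'E.
have lj : l != j by apply: contraNneq jB => <-.
rewrite (cardsD1 j) (cardsD1 l) !inE (negPf jB) jC lj lB (negPf lC) !add1n.
congr _.+2; apply: eq_card => i; rewrite !inE B'E !inE.
case: (eqVneq i l) => [->|il]; first by rewrite (negPf lj) (negPf lC).
by case: (eqVneq i j) => [->|ij]; rewrite ?jC.
Qed.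

(** * Paths of the pivot experts *)

(** A common weakening of both experts: the entering variable belongs to [Bopt], the leaving one
    passes the ratio test, and scores and tie-breaking are forgotten. *)
Definition guided_pivot (R : realType) (n : nat) (A : 'M[R]_(n, n + n))
    (b : 'cV[R]_n) (Bopt : nset n) : rel (nset n) :=
  fun B B' =>
    [exists j in val Bopt :\: val B,
     exists l in leaving A b B j, val B' == j |: (val B :\ l)]%SET.

Lemma expert_leaving_sub (R : realType) (n : nat) (A : 'M[R]_(n, n + n))
    (b : 'cV[R]_n) (Bopt B : nset n) j :
  expert_leaving A b Bopt B j \subset leaving A b B j.
Proof. by rewrite /expert_leaving; case: ifP => _ //; exact: subsetDl. Qed.

Lemma best_sub (R : realType) (n : nat) (A : 'M[R]_(n, n + n))
    (c : 'cV[R]_(n + n)) (B : nset n) S :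
  best A c B S \subset S.
Proof. by apply/fintype.subsetP => j; rewrite inE => /andP[]. Qed.

Lemma candidates_sub (R : realType) (n : nat) (A : 'M[R]_(n, n + n))
    (c : 'cV[R]_(n + n)) (Bopt B : nset n) :
  (candidates A c B :&: val Bopt \subset val Bopt :\: val B)%SET.
Proof. by apply/fintype.subsetP => j; rewrite !inE => /andP[/andP[-> _] ->]. Qed.

Lemma expert_guided (R : realType) (n : nat) (A : 'M[R]_(n, n + n))
    (b : 'cV[R]_n) (c : 'cV[R]_(n + n)) (Bopt : nset n) :
  subrel (expertI_pivot A b c Bopt) (guided_pivot A b Bopt) /\
  subrel (expertII_pivot A b c Bopt) (guided_pivot A b Bopt).
Proof.
have guided B B' j : j \in candidates A c B :&: val Bopt ->
    [exists l in expert_leaving A b Bopt B j, val B' == j |: (val B :\ l)]%SET ->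
    guided_pivot A b Bopt B B'.
  move=> jC /exists_inP[l lL B'E]; apply/exists_inP; exists j.
    exact: (fintype.subsetP (candidates_sub _ _ _ _)) jC.
  apply/exists_inP; exists l => //.
  exact: (fintype.subsetP (expert_leaving_sub _ _ _ _ _)) lL.
split=> B B' /exists_inP[j /(fintype.subsetP (best_sub _ _ _ _))].
  exact: guided.
by case: ifP => _; [|rewrite inE => /andP[+ _]]; apply: guided.
Qed.

Lemma guided_path_size (R : realType) (n : nat) (A : 'M[R]_(n, n + n))
    (b : 'cV[R]_n) (Bopt : nset n) :
  comb_equiv (polyhedron A b) (@cube R n) ->
  feasible_basis A b Bopt ->
  forall s B, feasible_basis A b B -> path (guided_pivot A b Bopt) B s ->
  ((size s).*2 <= #|disagree B Bopt|)%N.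
Proof.
move=> hcube fBopt; have [sigma sigmaP] := feasible_basis_pairing hcube.
elim=> [//|B' s IH] B fB /= /andP[/exists_inP[j]].
rewrite inE => /andP[jB jBopt] /exists_inP[l lL /eqP B'E] pth.
have fB' := pivot_feasible fB jB lL B'E.
have lB : l \in val B by case/imsetP: lL => k _ ->; apply/nset_idxP; exists k.
(* Since [j] is outside [B] and inside [B'], its partner [sigma j] is in [B] but not in [B'], so it
   is [l]. As [j] lies in [Bopt], the pairing for [Bopt] puts [l] outside it. *)
have : sigma j \notin val B' by rewrite sigmaP // B'E !inE eqxx.
rewrite B'E !inE negb_or negb_and sigmaP // jB orbF negbK => /andP[_ /eqP sj].
have lBopt : l \notin val Bopt by rewrite -sj sigmaP // jBopt.
by rewrite (disagree_exchange jB jBopt lB lBopt B'E) doubleS !ltnS IH.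
Qed.

Theorem theorem4 (R : realType) (n : nat) (hn : (1 <= n)%N)
    (A : 'M[R]_(n, n + n)) (b : 'cV[R]_n)
    (hA : row_free A)
    (hbounded : bounded_points (polyhedron A b))
    (hcube : comb_equiv (polyhedron A b) (@cube R n))
    (hnondeg : forall z, vertex (polyhedron A b) z -> nondegenerate_vertex z)
    (c : 'cV[R]_(n + n)) (Bopt : nset n)
    (hopt : unique (optimal_basis A b c) Bopt)
    (x0 y0 : 'cV[R]_n) (h0 : vertex (polyhedron A b) (col_mx x0 y0))
    (B0 : nset n) (hB0 : feasible_basis A b B0)
    (hB0z : basic_solution A b B0 = col_mx x0 y0)
    (s : seq (nset n))
    (hs : path (expertI_pivot A b c Bopt) B0 s \/
          path (expertII_pivot A b c Bopt) B0 s) :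
  (size s)%:R <= 2^-1 * diff_opt R Bopt B0 /\
  2^-1 * diff_opt R Bopt B0 <= n%:R.
Proof.
have [[fBopt _] _] := hopt.
have pth : path (guided_pivot A b Bopt) B0 s.
  by have [eI eII] := expert_guided A b c Bopt; case: hs; apply: sub_path.
have size_le := guided_path_size hcube fBopt hB0 pth.
rewrite diff_optE ler_pdivlMl ?ltr0n // ler_pdivrMl ?ltr0n //.
rewrite -!natrM !ler_nat !mul2n; split=> //.
(* The symmetric difference is a set of indices among [n + n]. *)
by rewrite -addnn -[X in (_ <= X)%N]card_ord; exact: max_card.
Qed.
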